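(* Let $s\ge 1$ be an integer, let $\mu_1,\ldots,\mu_s$ be probability measures on $\mathbb{R}$, let $\rho:\mathcal{P}(\mathbb{R})\to\mathbb{R}$ be a law-invariant risk measure, and let $\pi=(\pi_1,\ldots,\pi_s)\in\Sigma_s$. Let $X_1,X_2,\ldots$ be i.i.d. random variables with values in $\{1,\ldots,s\}$ and distribution $\pi$ (i.e. $P(X_i=j)=\pi_j$), and for $n\ge 1$ let $\hat{\pi}_n(j):=\frac{1}{n}\sum_{i=1}^n 1_{\{X_i=j\}}$ for $j\in\{1,\ldots,s\}$. Assume that the function $$\Sigma_s\ni(p_1,\ldots,p_s)\mapsto\rho\left(\sum_{j=1}^sp_j\mu_j\right)$$ is continuous. Then the sequence of real random variables $\left\{\rho\left(\sum_{j=1}^s\hat{\pi}_n(j)\mu_j\right):n\geq 1\right\}$ satisfies the large deviation principle (as $n\to\infty$) on $\mathbb{R}$ with good rate function $H_{\rho,\langle\pi,\mu\rangle}$ defined, for $r\in\mathbb{R}$, by $$H_{\rho,\langle\pi,\mu\rangle}(r):=\inf\left\{\sum_{j=1}^sp_j\log\frac{p_j}{\pi_j}:(p_1,\ldots,p_s)\in\Sigma_s,\ \rho\left(\sum_{j=1}^sp_j\mu_j\right)=r\right\}.$$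
   Context: $\mathcal{P}(\mathbb{R})$ is the set of probability measures on the real line; a law-invariant risk measure is any map $\rho:\mathcal{P}(\mathbb{R})\to\mathbb{R}$. The simplex is $\Sigma_s:=\{(p_1,\ldots,p_s):p_1,\ldots,p_s\geq 0,\ p_1+\cdots+p_s=1\}$. Conventions: $p_j\log\frac{p_j}{\pi_j}=0$ if $p_j=0$ (also when $\pi_j=0$), and $p_j\log\frac{p_j}{\pi_j}=\infty$ if $\pi_j=0$ and $p_j>0$; $\inf\emptyset=\infty$. A sequence of random variables $\{W_n:n\ge1\}$ with values in a topological space $\mathcal{W}$ satisfies the large deviation principle with rate function $I:\mathcal{W}\to[0,\infty]$ if $I$ is lower semicontinuous, $\liminf_{n\to\infty}\frac1n\log P(W_n\in O)\ge-\inf_{w\in O}I(w)$ for all open sets $O$, and $\limsup_{n\to\infty}\frac1n\log P(W_n\in C)\le-\inf_{w\in C}I(w)$ for all closed sets $C$. The rate function $I$ is good if all level sets $\{w\in\mathcal{W}:I(w)\le\eta\}$, $\eta\ge0$, are compact. *)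

(* Defs.v *)
From HB Require Import structures.
From mathcomp Require Import all_boot all_order all_algebra.
From mathcomp Require Import finmap.
From mathcomp Require Import all_classical all_reals all_analysis.

Set Implicit Arguments.
Unset Strict Implicit.
Unset Printing Implicit Defensive.

Import Order.TTheory GRing.Theory Num.Theory.
Import numFieldNormedType.Exports.

Local Open Scope classical_set_scope.
Local Open Scope ring_scope.

Definition simplex (R : realType) (s : nat) : set 'rV[R]_s :=
  [set p : 'rV[R]_s | (forall j, 0 <= p 0 j) /\ \sum_(j < s) p 0 j = 1].
Arguments simplex : clear implicits.

Section mixture.
Context d (T : measurableType d) (R : realType) (s : nat).
Variables (mu : 'I_s -> probability T R) (p : simplex R s).

Definition mixture (A : set T) : \bar R :=
  (\sum_(j < s) (set_val p 0 j)%:E * mu j A)%E.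

Let p_ge0 j : 0 <= set_val p 0 j.
Proof. by have [] := set_valP p. Qed.

Let mixture0 : mixture set0 = 0%E.
Proof. by rewrite /mixture big1// => j _; rewrite measure0 mule0. Qed.

Let mixture_ge0 A : (0 <= mixture A)%E.
Proof. by apply: sume_ge0 => j _; rewrite mule_ge0// lee_fin p_ge0. Qed.

Let mixture_sigma_additive : semi_sigma_additive mixture.
Proof.
pose m (k : nat) : {measure set T -> \bar R} :=
  if insub k is Some j then mscale (NngNum (p_ge0 j)) (mu j) else mzero.
suff -> : mixture = msum m s by exact: measure_semi_sigma_additive.
apply/funext => A; apply: eq_bigr => j _.
by rewrite /m valK.
Qed.

HB.instance Definition _ := isMeasure.Build _ _ _ mixture
  mixture0 mixture_ge0 mixture_sigma_additive.

Let mixture_setT : mixture setT = 1%E.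
Proof.
have [_ p1] := set_valP p.
rewrite /mixture; under eq_bigr do rewrite probability_setT mule1.
by rewrite sumEFin p1.
Qed.

HB.instance Definition _ :=
  Measure_isProbability.Build _ _ _ mixture mixture_setT.

End mixture.

(* The finite set 'I_s carries the sigma-algebra of all its subsets. *)
Definition discrete_random_variables d (T : measurableType d) (s : nat)
    (X : nat -> T -> 'I_s) : Prop :=
  forall i (A : set 'I_s), measurable (X i @^-1` A).

Definition mutually_independent d (T : measurableType d) (R : realType)
    (P : probability T R) (s : nat) (X : nat -> T -> 'I_s) : Prop :=
  forall (J : {fset nat}) (A : nat -> set 'I_s),
    P (\bigcap_(i in [set` J]) X i @^-1` A i) =
    (\prod_(i <- J) P (X i @^-1` A i))%E.

Section empirical.
Context (T : Type) (R : realType) (s : nat).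
Variables (X : nat -> T -> 'I_s) (n : nat) (w : T).

Definition frequencies : 'rV[R]_s :=
  \row_j (n.+1%:R^-1 * \sum_(i < n.+1) (X i w == j)%:R).

Lemma frequencies_simplex : simplex R s frequencies.
Proof.
split=> [j|]; first by rewrite mxE mulr_ge0// sumr_ge0.
under eq_bigr do rewrite mxE.
rewrite -mulr_sumr exchange_big/=.
under eq_bigr => i _.
  rewrite (bigD1 (X i w))//= eqxx big1 ?addr0; last first.
    by move=> j /negPf; rewrite eq_sym => ->.
  over.
by rewrite sumr_const card_ord mulVf// pnatr_eq0.
Qed.

(* With X_(i+1) written X i, this is hat(pi)_(n+1), the empirical distribution
   of X 0, ..., X n; the sample size n.+1 is positive, so that it lies in the
   simplex. *)
Definition empirical : simplex R s := SigSub (mem_set frequencies_simplex).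

End empirical.

(* For a sequence (W_n)_(n >= 1), Z n stands for W_(n+1); hence the speed n.+1.
   The first clause says that the W_n are random variables for the Borel
   sigma-algebra of W. *)
Definition large_deviation_principle d (T : measurableType d) (R : realType)
    (P : probability T R) (W : topologicalType) (Z : nat -> T -> W)
    (I : W -> \bar R) : Prop :=
  [/\ forall n O, open O -> measurable (Z n @^-1` O),
      forall w, (0 <= I w)%E,
      lower_semicontinuous I,
      forall O, open O ->
        (- ereal_inf (I @` O) <=
         limn_einf (fun n => (n.+1%:R^-1)%:E * lne (P (Z n @^-1` O))))%E
    & forall C, closed C ->
        (limn_esup (fun n => (n.+1%:R^-1)%:E * lne (P (Z n @^-1` C))) <=
         - ereal_inf (I @` C))%E].

Definition good_rate_function (R : realType) (W : topologicalType)
    (I : W -> \bar R) : Prop :=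
  forall eta : R, 0 <= eta -> compact [set w | (I w <= eta%:E)%E].

Definition xlog_div (R : realType) (x y : R) : \bar R :=
  if x == 0 then 0%E else if y == 0 then +oo%E else (x * ln (x / y))%:E.

Definition relative_entropy (R : realType) (s : nat) (p q : 'rV[R]_s) :
    \bar R :=
  (\sum_(j < s) xlog_div (p 0%R j) (q 0%R j))%E.

Definition mixture_rate (R : realType) (s : nat)
    (mu : 'I_s -> probability (measurableTypeR R) R)
    (rho : probability (measurableTypeR R) R -> R) (q : simplex R s) (r : R) :
    \bar R :=
  ereal_inf [set relative_entropy (set_val p) (set_val q)
            | p in [set p : simplex R s | rho (mixture mu p) = r]].

(* Main.v *)
Require Import Defs.
From HB Require Import structures.
From mathcomp Require Import all_boot all_order all_algebra.
From mathcomp Require Import finmap.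
From mathcomp Require Import all_classical all_reals all_analysis.
From mathcomp Require Import ring lra.

(* Sanov's theorem on a finite alphabet, followed by the contraction principle
   along p |-> rho (sum_j p_j mu_j), which is continuous on the simplex.
   Upper bound: a word x with type p has q-probability at most
   p^n(x) exp(-n D(p||q)); the words of a given type have total p^n-probability
   at most 1, and there are polynomially many types.
   Lower bound at p: by Chebyshev's inequality, a word drawn from p^n has a type
   close to p with probability tending to 1, and on such words changing p into q
   costs a factor exp(-n (D(p||q) + o(1))).
   The relative entropy has compact level sets because x ln x is continuous at 0
   and because D(p||q) is infinite exactly when p charges a zero of q. *)

Import Order.TTheory GRing.Theory Num.Theory.
Import numFieldNormedType.Exports.

Local Open Scope classical_set_scope.
Local Open Scope ring_scope.

Set Implicit Arguments.
Unset Strict Implicit.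

(** * Absolute continuity and finiteness of the relative entropy *)

Lemma relative_entropyE {R : realType} {s : nat} (p q : 'rV[R]_s) :
    (forall j, p 0 j != 0 -> q 0 j != 0) ->
  relative_entropy p q = (\sum_j p 0 j * ln (p 0 j / q 0 j))%:E.
Proof.
move=> pq; rewrite /relative_entropy -sumEFin; apply: eq_bigr => j _.
rewrite /xlog_div; case: ifPn => [/eqP ->|p0]; first by rewrite mul0r.
by rewrite (negPf (pq _ p0)).
Qed.

(** No summand is [-oo], so a single letter charged by [p] but not by [q] makes the whole sum
    [+oo]. *)
Lemma relative_entropy_lty {R : realType} {s : nat} (p q : 'rV[R]_s) :
    (relative_entropy p q < +oo)%E ->
  forall j, p 0 j != 0 -> q 0 j != 0.
Proof.
move=> + j p0; apply: contraTN => q0.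
suff -> : relative_entropy p q = +oo%E by [].
apply/esum_eqyP => [i _|].
  by rewrite /xlog_div; case: ifP => // _; case: ifP.
by exists j; rewrite /xlog_div (negPf p0) q0.
Qed.

(** * Words, their types, and their weights under product measures *)

Section words.
Context {R : realType} {s n : nat}.
Local Notation word := {ffun 'I_n.+1 -> 'I_s}.
Implicit Types (x : word) (p q : 'rV[R]_s).

(** A word serves as its own sample point, with its coordinates as the random variables; [inord]
    turns a natural index into a position. *)
Definition word_type x : simplex R s :=
  empirical R (fun i (x : word) => x (inord i)) n x.

(** The probability of [x] under the product of [n.+1] copies of [p]. *)
Definition weight p x : R := \prod_i p 0 (x i).

Lemma word_typeE x j :
  set_val (word_type x) 0 j = n.+1%:R^-1 * \sum_i (x i == j)%:R.
Proof.
rewrite mxE; congr (_ * _); apply: eq_bigr => i _.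
by rewrite inord_val.
Qed.

(** Grouping positions by letter shows that an additive functional of a word depends only on its
    type. *)
Lemma sum_word x (g : 'I_s -> R) :
  \sum_i g (x i) = n.+1%:R * \sum_j set_val (word_type x) 0 j * g j.
Proof.
under [in RHS]eq_bigr do rewrite word_typeE -mulrA.
rewrite -mulr_sumr mulrA mulfV ?pnatr_eq0// mul1r.
under [RHS]eq_bigr do rewrite mulr_suml.
rewrite exchange_big/=; apply: eq_bigr => i _.
rewrite (bigD1 (x i))//= eqxx mul1r big1 ?addr0// => j /negPf.
by rewrite eq_sym => ->; rewrite mul0r.
Qed.

Lemma word_type_gt0 x i : 0 < set_val (word_type x) 0 (x i).
Proof.
rewrite word_typeE mulr_gt0 ?invr_gt0 ?ltr0Sn// (bigD1 i)//= eqxx.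
by rewrite ltr_pwDl// sumr_ge0.
Qed.

Lemma weight_ge0 p x : simplex R s p -> 0 <= weight p x.
Proof. by move=> [p0 _]; apply: prodr_ge0. Qed.

Lemma sum_weight p : simplex R s p -> \sum_x weight p x = 1.
Proof.
move=> [_ p1]; rewrite -(bigA_distr_bigA (fun _ j => p 0 j)) /=.
by rewrite big1.
Qed.

Lemma weight_variance p (a : 'I_s -> R) : simplex R s p ->
    \sum_j p 0 j * a j = 0 ->
  \sum_x weight p x * (\sum_i a (x i)) ^+ 2 =
  n.+1%:R * \sum_j p 0 j * a j ^+ 2.
Proof.
move=> ps pa0.
(* Encodes a (x i) * a (x k) as a product over all coordinates, so that the
   expectation factorizes; it vanishes for i != k because a is centered. *)
pose c (i k l : 'I_n.+1) j :=
  (if l == i then a j else 1) * (if l == k then a j else 1).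
have cE i k x : a (x i) * a (x k) = \prod_l c i k l (x l).
  by rewrite big_split/= -!big_mkcond/= (big_pred1 i)// (big_pred1 k).
transitivity (\sum_i \sum_k \sum_x weight p x * (a (x i) * a (x k))).
  under [RHS]eq_bigr do rewrite exchange_big/=.
  rewrite [RHS]exchange_big/=; apply: eq_bigr => x _.
  rewrite expr2 mulr_suml mulr_sumr; apply: eq_bigr => i _.
  by rewrite !mulr_sumr.
rewrite -[n.+1 in RHS]card_ord -sumr_const mulr_suml.
apply: eq_bigr => i _; rewrite mul1r.
have E k : \sum_x weight p x * (a (x i) * a (x k)) =
    \prod_l \sum_j p 0 j * c i k l j.
  rewrite bigA_distr_bigA; apply: eq_bigr => x _.
  by rewrite cE -big_split.
rewrite (bigD1 i)//= [X in _ + X]big1 ?addr0 => [|k ki].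
  rewrite E (bigD1 i)//= [X in _ * X]big1 ?mulr1 => [|l /negPf li].
    by apply: eq_bigr => j _; rewrite /c eqxx.
  by rewrite -[RHS](proj2 ps); apply: eq_bigr => j _; rewrite /c li !mulr1.
rewrite E (bigD1 i)//= [X in X * _](_ : _ = 0) ?mul0r//.
rewrite -[RHS]pa0; apply: eq_bigr => j _.
by rewrite /c eqxx eq_sym (negPf ki) mulr1.
Qed.

(** Chebyshev's inequality with a union bound over letters: the indicator of the event is at most
    the sum over [j] of the squared deviations divided by [e ^+ 2]. *)
Lemma weight_tail p (e : R) : simplex R s p -> 0 < e ->
  \sum_(x | [exists j, e <= `|set_val (word_type x) 0 j - p 0 j|]) weight p x
  <= s%:R / (n.+1%:R * e ^+ 2).
Proof.
move=> ps e0.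
have N0 : (0 : R) < n.+1%:R by rewrite ltr0Sn.
apply: (@le_trans _ _ (\sum_x \sum_j weight p x *
    ((set_val (word_type x) 0 j - p 0 j) ^+ 2 / e ^+ 2))).
  rewrite big_mkcond; apply: ler_sum => x _.
  have t0 j : 0 <= weight p x *
      ((set_val (word_type x) 0 j - p 0 j) ^+ 2 / e ^+ 2).
    by rewrite mulr_ge0 ?weight_ge0// divr_ge0 ?sqr_ge0.
  case: ifPn => [/existsP[j ej]|_]; last by rewrite sumr_ge0.
  rewrite (bigD1 j)//= -[leLHS]addr0 lerD ?sumr_ge0//.
  rewrite ler_peMr ?weight_ge0// ler_pdivlMr ?exprn_gt0// mul1r.
  by rewrite -[leRHS]real_normK ?num_real// lerXn2r ?nnegrE// ltW.
rewrite exchange_big/= -[s in leRHS]card_ord -sumr_const mulr_suml.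
apply: ler_sum => j _; rewrite mul1r.
(* The centred indicator of the letter [j], to which [weight_variance] applies; its variance is at
   most 1. *)
pose a k : R := (k == j)%:R - p 0 j.
have aE x : set_val (word_type x) 0 j - p 0 j = n.+1%:R^-1 * \sum_i a (x i).
  rewrite word_typeE /a sumrB sumr_const card_ord mulrBr.
  by rewrite -[X in _ - _ * X]mulr_natl mulKf.
have a0 : \sum_k p 0 k * a k = 0.
  under eq_bigr do rewrite /a mulrBr.
  rewrite sumrB -mulr_suml (proj2 ps) mul1r (bigD1 j)//= eqxx mulr1 big1.
    by rewrite addr0 subrr.
  by move=> k /negPf ->; rewrite mulr0.
have a1 : \sum_k p 0 k * a k ^+ 2 <= 1.
  rewrite -[leRHS](proj2 ps); apply: ler_sum => k _.
  have p0 := proj1 ps k; have pj0 := proj1 ps j.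
  have pj1 : p 0 j <= 1.
    by rewrite -(proj2 ps) (bigD1 j)//= lerDl sumr_ge0// => i _; exact: ps.1.
  by rewrite ler_piMr// /a; case: (k == j) => /=; nra.
rewrite (eq_bigr (fun x => (n.+1%:R ^- 2 / e ^+ 2) *
    (weight p x * (\sum_i a (x i)) ^+ 2))); last first.
  by move=> x _; rewrite aE; field; rewrite !gt_eqF.
rewrite -mulr_sumr weight_variance//.
rewrite (_ : _ * _ = (n.+1%:R * e ^+ 2)^-1 * \sum_j p 0 j * a j ^+ 2).
  by rewrite ler_piMr// invr_ge0 mulr_ge0// sqr_ge0.
by field; rewrite !gt_eqF.
Qed.

(** Change of measure: the likelihood ratio is a product over positions, so its logarithm is
    additive and [sum_word] expresses it through the type. *)
Lemma weight_tilt p q x :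
    (forall i, 0 < p 0 (x i)) -> (forall i, 0 < q 0 (x i)) ->
  weight q x = weight p x *
    expR (- (n.+1%:R * \sum_j set_val (word_type x) 0 j * ln (p 0 j / q 0 j))).
Proof.
move=> p0 q0; rewrite -sum_word -sumrN expR_sum -big_split/=.
apply: eq_bigr => i _.
rewrite -lnV ?posrE ?divr_gt0// lnK ?posrE ?invr_gt0 ?divr_gt0//.
by rewrite invf_div mulrC divfK// gt_eqF.
Qed.

(** Tilting from the word's own type to [q] makes the exponent exactly the relative entropy. If [q]
    misses a letter of [x], the left side is 0. *)
Lemma weight_entropy q x (m : R) : simplex R s q ->
    (m%:E <= relative_entropy (set_val (word_type x)) q)%E ->
  weight q x <=
  weight (set_val (word_type x)) x * expR (- (n.+1%:R * m)).
Proof.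
move=> [q0 _] mD.
have tw0 : 0 <= (weight (set_val (word_type x)) x : R).
  exact: (weight_ge0 _ (set_valP _)).
have [[i qi0]|qx] := pselect (exists i, q 0 (x i) = 0).
  by rewrite /weight (bigD1 i)//= qi0 mul0r mulr_ge0// expR_ge0.
have {}qx i : 0 < q 0 (x i).
  by rewrite lt0r q0 andbT; apply/eqP => qi; apply: qx; exists i.
rewrite (weight_tilt (word_type_gt0 x) qx) ler_wpM2l// ler_expR lerN2.
rewrite ler_pM2l ?ltr0Sn// -lee_fin -relative_entropyE// => j.
apply: contraNN => /eqP qj0; rewrite word_typeE big1 ?mulr0// => i _.
by case: eqP => // xij; have := qx i; rewrite xij qj0 ltxx.
Qed.

Lemma weight_upper q (B : set (simplex R s)) (m : R) : simplex R s q ->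
    (forall r, B r -> (m%:E <= relative_entropy (set_val r) q)%E) ->
  \sum_(x : word | word_type x \in B) weight q x <=
  n.+2%:R ^+ s * expR (- (n.+1%:R * m)).
Proof.
move=> qs mB.
have wt0 (x y : word) : 0 <= (weight (set_val (word_type x)) y : R).
  exact: (weight_ge0 _ (set_valP _)).
apply: (@le_trans _ _ (\sum_(x : word) weight (set_val (word_type x)) x *
    expR (- (n.+1%:R * m)))).
  rewrite big_mkcond; apply: ler_sum => x _; case: ifPn => [|_].
    by rewrite inE => /mB; exact: weight_entropy.
  by rewrite mulr_ge0// expR_ge0.
rewrite -mulr_suml ler_wpM2r ?expR_ge0//.
(* Each letter occurs between 0 and [n.+1] times, so a type is coded by [s] numbers in ['I_n.+2]. *)
pose count x : {ffun 'I_s -> 'I_n.+2} :=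
  [ffun j => inord (\sum_i (x i == j))].
have countE x y : count x = count y -> word_type x = word_type y :> simplex R s.
  move=> /ffunP xy; apply/val_inj/rowP => j.
  change (set_val (word_type x) 0 j = set_val (word_type y) 0 j :> R).
  have cnt (z : word) : (\sum_i (z i == j) < n.+2)%N.
    rewrite ltnS -[leqRHS]card_ord -sum1_card leq_sum// => i _.
    by case: (_ == _).
  rewrite !word_typeE -!natr_sum; congr (_ * _%:R).
  by have := xy j; rewrite !ffunE => /(congr1 val); rewrite /= !inordK.
rewrite (partition_big count predT)//=.
rewrite -natrX -[n.+2 in leRHS]card_ord -[s in leRHS]card_ord -card_ffun.
rewrite -sumr_const.
apply: ler_sum => k _.
have [[y yk]|nok] := pselect (exists y, count y = k); last first.
  by rewrite big1// => x /eqP xk; case: nok; exists x.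
(* All words of this fibre share the type of [y], so their weights add up to at most the total mass
   1 of a single product measure. *)
rewrite -(sum_weight (set_valP (word_type y))).
rewrite [leRHS](bigID (fun x => count x == k))/= -[leLHS]addr0 lerD//.
  by apply: ler_sum => x /eqP xk; rewrite (@countE x y)// yk.
by apply: sumr_ge0 => z _; exact: wt0.
Qed.

(** At a type within [e] of [p], replacing the type by [p] in the exponent of [weight_tilt] costs at
    most [e] times the sum of the absolute logarithms; [weight_tail] bounds the [p]-mass of the
    remaining words. *)
Lemma weight_lower p q (B : set (simplex R s)) (e : R) :
    simplex R s p -> simplex R s q -> (forall j, p 0 j != 0 -> q 0 j != 0) ->
    0 < e ->
    (forall r : simplex R s, (forall j, `|set_val r 0 j - p 0 j| < e) -> B r) ->
  expR (- (n.+1%:R * (\sum_j p 0 j * ln (p 0 j / q 0 j) +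
                      e * \sum_j `|ln (p 0 j / q 0 j)|))) *
  (1 - s%:R / (n.+1%:R * e ^+ 2)) <=
  \sum_(x : word | word_type x \in B) weight q x.
Proof.
move=> ps qs pq e0 eB.
set D := (X in expR X).
pose far x := [exists j, e <= `|set_val (word_type x) 0 j - p 0 j|].
apply: (@le_trans _ _ (\sum_(x | ~~ far x) expR D * weight p x)).
  rewrite -mulr_sumr ler_wpM2l ?expR_ge0//.
  rewrite -[X in X - _](sum_weight ps) (bigID far)/=.
  rewrite lerBlDr [leRHS]addrC lerD2r.
  exact: weight_tail.
rewrite big_mkcond [leRHS]big_mkcond/=; apply: ler_sum => x _.
case: ifPn => [|_]; last by case: ifP => // _; exact: weight_ge0.
rewrite negb_exists => /forallP near.
have {}near j : `|set_val (word_type x) 0 j - p 0 j| < e by rewrite ltNge near.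
rewrite ifT; last by rewrite inE; exact: eB.
(* A word using a letter of [p]-mass 0 contributes nothing on the left; every other word meets the
   positivity conditions of [weight_tilt]. *)
have [[i pi0]|px] := pselect (exists i, p 0 (x i) = 0).
  by rewrite {1}/weight (bigD1 i)//= pi0 mul0r mulr0 weight_ge0.
have {}px i : p 0 (x i) != 0 by apply/eqP => pi; apply: px; exists i.
have qx i : 0 < q 0 (x i) by rewrite lt0r pq//= (proj1 qs).
have {}px i : 0 < p 0 (x i) by rewrite lt0r px (proj1 ps).
rewrite (weight_tilt px qx) mulrC ler_wpM2l ?weight_ge0//.
rewrite ler_expR lerN2 ler_wpM2l// mulr_sumr -big_split/=.
apply: ler_sum => j _; rewrite -lerBlDl -mulrBl (le_trans (ler_norm _))//.
by rewrite normrM ler_wpM2r// ltW.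
Qed.

End words.

(** * The law of the empirical distribution as a sum over words *)

Section empirical_law.
Context {R : realType} {s : nat} {d : measure_display} {T : measurableType d}.
Context (P : probability T R) (X : nat -> T -> 'I_s) (q : simplex R s).
Context (X_rv : discrete_random_variables X)
  (X_indep : mutually_independent P X)
  (X_law : forall i j, P (X i @^-1` [set j]) = (set_val q 0 j)%:E).

(** Indexed by a finite set of naturals, the form to which [mutually_independent] applies
    directly. *)
Let cylinder n (x : {ffun 'I_n.+1 -> 'I_s}) : set T :=
  \bigcap_(i in [set` seq_fset tt (iota 0 n.+1)]) X i @^-1` [set x (inord i)].

Let cylinderP n (x : {ffun 'I_n.+1 -> 'I_s}) w :
  cylinder x w <-> forall i : 'I_n.+1, X i w = x i.
Proof.
have memJ i : (i \in seq_fset tt (iota 0 n.+1)) = (i < n.+1)%N.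
  by rewrite seq_fsetE mem_iota.
split=> [xw i|xw i iJ].
  have iJ : (i : nat) \in seq_fset tt (iota 0 n.+1) by rewrite memJ.
  by have -> : X i w = x (inord i) := xw _ iJ; rewrite inord_val.
have {}iJ : (i < n.+1)%N by rewrite -memJ.
change (X i w = x (inord i)); rewrite (xw (Ordinal iJ)).
by congr (x _); apply/val_inj; rewrite /= inordK.
Qed.

Let measurable_cylinder n (x : {ffun 'I_n.+1 -> 'I_s}) :
  measurable (cylinder x).
Proof. by apply: fin_bigcap_measurable => // i _; exact: X_rv. Qed.

Let cylinder_prob n (x : {ffun 'I_n.+1 -> 'I_s}) :
  P (cylinder x) = (weight (set_val q) x)%:E.
Proof.
rewrite /cylinder X_indep.
under eq_bigr do rewrite X_law.
rewrite prodEFin; congr (_%:E).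
rewrite (perm_big (iota 0 n.+1)); last first.
  by apply: uniq_perm; rewrite ?fset_uniq ?iota_uniq// => i; rewrite seq_fsetE.
rewrite -[iota 0 n.+1]/(index_iota 0 n.+1) big_mkord.
by apply: eq_bigr => i _; rewrite inord_val.
Qed.

(** The empirical distribution depends only on the word formed by the first [n.+1] samples. *)
Let preimage_empirical n (B : set (simplex R s)) :
  empirical R X n @^-1` B =
  \bigcup_(x in [set x : {ffun 'I_n.+1 -> 'I_s} | word_type x \in B])
    cylinder x.
Proof.
have empE (x : {ffun 'I_n.+1 -> 'I_s}) w : (forall i : 'I_n.+1, X i w = x i) ->
    empirical R X n w = word_type x.
  move=> xw; apply/val_inj/rowP => j; rewrite !mxE; congr (_ * _).
  by apply: eq_bigr => i _; rewrite inord_val xw.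
apply/seteqP; split=> [w Bw|w [x xB /cylinderP xw]].
  have xw : forall i : 'I_n.+1, X i w = [ffun i : 'I_n.+1 => X i w] i.
    by move=> i; rewrite ffunE.
  exists [ffun i : 'I_n.+1 => X i w]; last exact/cylinderP.
  by rewrite /= -(empE _ _ xw) inE.
by rewrite /= (empE _ _ xw) -inE.
Qed.

Lemma measurable_empirical n (B : set (simplex R s)) :
  measurable (empirical R X n @^-1` B).
Proof.
by rewrite preimage_empirical; exact: fin_bigcup_measurable.
Qed.

Lemma empirical_prob n (B : set (simplex R s)) :
  P (empirical R X n @^-1` B) =
  (\sum_(x : {ffun 'I_n.+1 -> 'I_s} | word_type x \in B)
     weight (set_val q) x)%:E.
Proof.
rewrite preimage_empirical measure_fin_bigcup; last 3 first.
- exact: finite_finset.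
- apply/trivIsetP => x y _ _ /eqP xy; rewrite -subset0 => w [] /cylinderP xw.
  move=> /cylinderP yw; apply: xy; apply/ffunP => i.
  by rewrite -xw -yw.
- by move=> x _; exact: measurable_cylinder.
rewrite -(bigfs _ (index_enum_uniq _)) => [|x _]; last first.
  by rewrite mem_index_enum.
by rewrite -sumEFin; apply: eq_bigr => x _; exact: cylinder_prob.
Qed.

End empirical_law.

(** * Eventual bounds and the growth of the logarithm *)

Section limits.
Context {R : realType}.
Implicit Type u : nat -> \bar R.

(** [limn_esup] is an infimum of suprema over the sets of the filter at infinity, and the set where
    the bound holds is one of them. *)
Lemma limn_esup_le_near u c :
  (\forall n \near \oo, (u n <= c)%E) -> (limn_esup u <= c)%E.
Proof.
move=> uc; apply: ge_ereal_inf.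
exists (ereal_sup (u @` [set n | (u n <= c)%E])).
  by exists [set n | (u n <= c)%E].
by apply: ge_ereal_sup => _ [n + <-].
Qed.

Lemma limn_einf_ge_near u c :
  (\forall n \near \oo, (c <= u n)%E) -> (c <= limn_einf u)%E.
Proof.
move=> uc; rewrite /limn_einf leeNr; apply: limn_esup_le_near.
by apply: filterS uc => n; rewrite leeN2.
Qed.

(** Makes the number of types negligible on the exponential scale. The bound [ln y <= y - 1] is
    taken at [y = a * n.+2], with [a] small enough that [k * a <= e / 2]. *)
Lemma near_ln_le (k : nat) (e : R) : 0 < e ->
  \forall n \near \oo, k%:R * ln n.+2%:R <= n.+1%:R * e.
Proof.
move=> e0; pose a : R := e / (2 * k.+1%:R).
have k0 : (0 : R) < k.+1%:R by rewrite ltr0Sn.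
have a0 : 0 < a by rewrite divr_gt0// mulr_gt0.
near=> n.
have n2 : (0 : R) < n.+2%:R by rewrite ltr0Sn.
have := @le_ln1Dx R (a * n.+2%:R - 1); rewrite addrCA subrr addr0 lnM ?posrE//.
rewrite -subr_gt0 opprK subrK mulr_gt0// => /(_ isT) ln2.
have {}ln2 : ln n.+2%:R <= a * n.+2%:R - 1 - ln a by lra.
apply: (le_trans (ler_wpM2l (ler0n _ k) ln2)).
have kn : 2 * k%:R * (- 1 - ln a) / e <= n%:R by near: n; exact: nbhs_infty_ger.
rewrite ler_pdivrMr// in kn.
have ka : k%:R * a <= e / 2.
  by rewrite /a mulrA ler_pdivrMr ?mulr_gt0// -[k.+1]addn1 natrD; lra.
have : k%:R * a * n.+2%:R <= e / 2 * n.+2%:R by rewrite ler_wpM2r.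
rewrite -[n.+2]addn2 -[n.+1]addn1 !natrD; lra.
Unshelve. all: by end_near. Qed.

End limits.

(** * Exponential bounds for sums of weights *)

Section sanov_bounds.
Context {R : realType} {s : nat} (q : simplex R s).
Local Notation D :=
  (fun p : simplex R s => relative_entropy (set_val p) (set_val q)).
Let S n (B : set (simplex R s)) : R :=
  \sum_(x : {ffun 'I_n.+1 -> 'I_s} | word_type x \in B) weight (set_val q) x.

Lemma weight_sum_upper (B : set (simplex R s)) :
  (limn_esup (fun n => (n.+1%:R^-1)%:E * lne (S n B)%:E) <=
   - ereal_inf (D @` B))%E.
Proof.
set u := fun n => _.
(* Testing against real [m] also covers an infimum equal to [+oo]: every [m] then qualifies and the
   limit superior is [-oo]. *)
have H (m : R) : (m%:E <= ereal_inf (D @` B))%E -> (limn_esup u <= (- m)%:E)%E.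
  move=> mB; apply/lee_addgt0Pr => e e0; apply: limn_esup_le_near.
  have mD p : B p -> (m%:E <= relative_entropy (set_val p) (set_val q))%E.
    by move=> Bp; apply: (le_trans mB); apply: ereal_inf_lbound; exists p.
  near=> n.
  have N0 : (0 : R) < n.+1%:R by rewrite ltr0Sn.
  have := weight_upper (n := n) (set_valP q) mD; rewrite -/(S n B) => SB.
  (* [lne] is [-oo] at nonpositive arguments, which settles this case; otherwise real logarithms
     apply. *)
  rewrite /u; have [S0|S0] := leP (S n B) 0.
    by rewrite le0_lneNy ?lee_fin// gt0_muleNy ?lte_fin ?invr_gt0// leNye.
  rewrite lne_EFin// -EFinM -EFinD lee_fin mulrC ler_pdivrMr//.
  apply: (@le_trans _ _ (ln (n.+2%:R ^+ s * expR (- (n.+1%:R * m))))).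
    by rewrite ler_ln// posrE mulr_gt0 ?expR_gt0// exprn_gt0.
  rewrite lnM ?posrE ?expR_gt0 ?exprn_gt0// expRK lnXn// -[X in X - _]mulr_natl.
  have : s%:R * ln n.+2%:R <= n.+1%:R * e by near: n; exact: near_ln_le.
  by lra.
case: (ereal_inf _) H => [m||] H.
- by rewrite -EFinN; exact: H.
- rewrite leeNr leye_eq; apply/eqP/eqyP => A _; rewrite leeNr.
  by apply: H; rewrite leey.
- by rewrite leey.
Unshelve. all: by end_near. Qed.

(** An open set of the simplex is the trace of an open set of row vectors, whose balls are defined
    entrywise. *)
Lemma simplex_open_ball (B : set (simplex R s)) (p : simplex R s) :
    open B -> B p ->
  exists2 e : R, 0 < e & forall r : simplex R s,
    (forall j, `|set_val r 0 j - set_val p 0 j| < e) -> B r.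
Proof.
move=> [W oW <-] /= Wp.
have /nbhs_ballP[e /= e0 eW] := open_nbhs_nbhs (conj oW Wp).
exists e => // r rp; apply: eW; split => // i j.
by rewrite ord1 /ball/= distrC.
Qed.

Lemma weight_sum_lower (B : set (simplex R s)) : open B ->
  (- ereal_inf (D @` B) <=
   limn_einf (fun n => (n.+1%:R^-1)%:E * lne (S n B)%:E))%E.
Proof.
move=> oB; rewrite leeNl; apply: le_ereal_inf_tmp => _ [p Bp <-].
rewrite leeNl; set u := fun n => _.
have [Dy|/relative_entropy_lty pq] := leP +oo%E (D p).
  by move: Dy; rewrite leye_eq => /eqP ->; rewrite leNye.
rewrite relative_entropyE//; set Dp := \sum_j _.
rewrite -EFinN; apply/lee_subgt0Pr => e e0.
have [e1 e10 e1B] := simplex_open_ball oB Bp.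
pose K := \sum_j `|ln (set_val p 0 j / set_val q 0 j)|.
have K0 : 0 <= K by apply: sumr_ge0.
(* The radius keeps the neighbourhood inside [B] and the tilting error [c * K] below [e / 2];
   [K + 1] keeps the denominator positive. *)
pose c := Num.min e1 (e / (2 * (K + 1))).
have c0 : 0 < c by rewrite lt_min e10/= divr_gt0// mulr_gt0// ltr_wpDl.
have cK : c * K <= e / 2.
  apply: (@le_trans _ _ (e / (2 * (K + 1)) * K)).
    by rewrite ler_wpM2r// ge_min lexx orbT.
  rewrite mulrAC ler_pdivrMr ?mulr_gt0// ?ltr_wpDl//; nra.
have cB (r : simplex R s) :
    (forall j, `|set_val r 0 j - set_val p 0 j| < c) -> B r.
  move=> rp; apply: e1B => j; apply: (lt_le_trans (rp j)).
  by rewrite ge_min lexx.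
apply: limn_einf_ge_near; near=> n.
have N0 : (0 : R) < n.+1%:R by rewrite ltr0Sn.
have := weight_lower (n := n) (set_valP p) (set_valP q) pq c0 cB.
rewrite -/(S n B) -/Dp -/K => SB.
(* The Chebyshev factor is at least one half once [n] exceeds [2 * s / c ^+ 2]. *)
have half : 2^-1 <= 1 - s%:R / (n.+1%:R * c ^+ 2) :> R.
  rewrite lerBrDr -lerBrDl ler_pdivrMr ?mulr_gt0 ?exprn_gt0//.
  have : s%:R / c ^+ 2 * 2 <= n%:R by near: n; exact: nbhs_infty_ger.
  rewrite mulrAC ler_pdivrMr ?exprn_gt0// -[n.+1]addn1 natrD.
  have : 0 < c ^+ 2 by rewrite exprn_gt0.
  by move: (c ^+ 2) => c2; nra.
set E := expR _ in SB.
have S1 : E * 2^-1 <= S n B.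
  by apply: le_trans SB; rewrite ler_wpM2l// expR_ge0.
have E0 : 0 < E by rewrite expR_gt0.
have S0 : 0 < S n B by apply: lt_le_trans S1; rewrite mulr_gt0.
rewrite /u lne_EFin// -EFinM -EFinB lee_fin mulrC ler_pdivlMr//.
apply: (@le_trans _ _ (ln (E * 2^-1))); last by rewrite ler_ln// posrE mulr_gt0.
rewrite lnM ?posrE// expRK lnV ?posrE//.
(* The other half of the error [e] absorbs the [ln 2] coming from that factor. *)
have : ln 2 * 2 / e <= n%:R by near: n; exact: nbhs_infty_ger.
rewrite ler_pdivrMr// -[n.+1]addn1 natrD => n2; have n0 : (0 : R) <= n%:R by [].
nra.
Unshelve. all: by end_near. Qed.

End sanov_bounds.

(** * Positivity and closed level sets of the relative entropy *)

Section entropy_function.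
Context {R : realType}.

Lemma continuous_mul_ln : continuous (fun x : R => x * ln x).
Proof.
move=> x; have [x0|x0|->] := ltgtP x 0.
(* At negative points the function is locally 0, since [ln] is 0 there by default. *)
- rewrite /continuous_at (ln0 (ltW x0)) mulr0; apply: cvg_near_cst.
  by near=> y; rewrite ln0 ?mulr0// ltW//; near: y; exact: lt_nbhsl.
- by apply: cvgM => //; exact: continuous_ln.
rewrite /continuous_at mul0r; apply/cvgr0Pnorm_lt => e e0.
(* With [y = t ^+ 2] and [- ln t < t^-1], the modulus of [y * ln y] is below [2 * t], hence below
   [e] when [y < (e / 2) ^+ 2]; the bound 1 fixes the sign of [ln y]. *)
exists (Num.min 1 ((e / 2) ^+ 2)) => /=.
  by rewrite lt_min ltr01/= exprn_gt0// divr_gt0.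
move=> y; rewrite /= sub0r normrN lt_min => /andP[y1 ye].
have [y0|y0] := leP y 0; first by rewrite ln0// mulr0 normr0.
rewrite (gtr0_norm y0) in y1 ye.
pose t := Num.sqrt y.
have t0 : 0 < t by rewrite sqrtr_gt0.
have yt : y = t ^+ 2 by rewrite sqr_sqrtr// ltW.
have te : t < e / 2.
  by rewrite -(ltr_pXn2r (n := 2))// ?nnegrE ?ltW ?divr_gt0// -yt.
have := ln_sublinear (x := t^-1); rewrite invr_gt0 lnV ?posrE// => /(_ t0) lnt.
have lny : ln y <= 0 by apply: ln_le0; exact: ltW.
rewrite normrM (ler0_norm lny) (gtr0_norm y0) [in ln y]yt lnXn//.
have tt : t * (- ln t) < 1 by rewrite -ltr_pdivlMl// mulr1.
rewrite yt; nra.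
Unshelve. all: by end_near. Qed.

Context {s : nat}.
Implicit Types p q : 'rV[R]_s.

(** Gibbs' inequality: [ln y <= y - 1] at [y = q_j / p_j] bounds each term below by [p_j - q_j], and
    these differences sum to 0. *)
Lemma relative_entropy_ge0 p q : simplex R s p -> simplex R s q ->
  (0 <= relative_entropy p q)%E.
Proof.
move=> [p0 p1] [q0 q1].
have [|/relative_entropy_lty pq] := leP +oo%E (relative_entropy p q).
  by apply: le_trans; rewrite leey.
rewrite relative_entropyE// lee_fin.
apply: (@le_trans _ _ (\sum_j (p 0 j - q 0 j))).
  by rewrite sumrB p1 q1 subrr.
apply: ler_sum => j _; have [->|pj] := eqVneq (p 0 j) 0.
  by rewrite mul0r sub0r oppr_le0.
have {}qj : 0 < q 0 j by rewrite lt0r pq//= q0.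
have {}pj : 0 < p 0 j by rewrite lt0r pj p0.
have := @le_ln1Dx R (q 0 j / p 0 j - 1).
rewrite addrCA subrr addr0 -subr_gt0 opprK subrK divr_gt0// => /(_ isT).
rewrite -(invf_div (p 0 j)) lnV ?posrE ?divr_gt0// invf_div => ln1.
have : p 0 j * - ln (p 0 j / q 0 j) <= p 0 j * (q 0 j / p 0 j - 1).
  by rewrite ler_pM2l.
by rewrite mulrBr mulr1 mulrCA mulfV ?gt_eqF// mulr1 mulrN; lra.
Qed.

Lemma closed_simplex : closed (simplex R s).
Proof.
rewrite (_ : simplex R s = (\bigcap_j [set p : 'rV[R]_s | 0 <= p 0 j]) `&`
    [set p | \sum_j p 0 j = 1]); last first.
  by apply/seteqP; split=> p [p0 p1]; split=> // j; [move=> _|]; exact: p0.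
apply: closedI.
  apply: closed_bigI => j _.
  apply: (@preimage_closed _ _ (fun p : 'rV[R]_s => p 0 j) [set x | 0 <= x]).
    by move=> p _; exact: coord_continuous.
  exact: closed_ge.
apply: (@preimage_closed _ _ (fun p : 'rV[R]_s => \sum_j p 0 j) [set 1]).
  move=> p _; apply: (continuous_big add_continuous) => j _.
  exact: coord_continuous.
exact: closed_eq.
Qed.

(** Finite entropy splits into the closed conditions [p_j = 0] at the zeros of [q] and a bound on a
    real function that is continuous everywhere. *)
Lemma closed_entropy_level q (eta : R) :
  closed [set p | simplex R s p /\ (relative_entropy p q <= eta%:E)%E].
Proof.
rewrite (_ : [set p | _] = simplex R s `&`
    ((\bigcap_(j in [set j | q 0 j = 0]) [set p : 'rV[R]_s | p 0 j = 0]) `&`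
    [set p | \sum_j p 0 j * ln (p 0 j / q 0 j) <= eta])); last first.
  apply/seteqP; split=> p [ps]; last first.
    move=> [pq pD]; split=> //; rewrite relative_entropyE ?lee_fin// => j.
    by apply: contraNN => /eqP qj; apply/eqP; exact: pq.
  move=> pD; split => //.
  have pq := relative_entropy_lty (le_lt_trans pD (ltry _)).
  split; last by move: pD; rewrite relative_entropyE.
  by move=> j /= qj; have [//|/pq] := eqVneq (p 0 j) 0; rewrite qj eqxx.
apply: closedI; first exact: closed_simplex.
apply: closedI.
  apply: closed_bigI => j _.
  apply: (@preimage_closed _ _ (fun p : 'rV[R]_s => p 0 j) [set 0]).
    by move=> p _; exact: coord_continuous.
  exact: closed_eq.
apply: (@preimage_closed _ _
    (fun p : 'rV[R]_s => \sum_j p 0 j * ln (p 0 j / q 0 j))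
    [set x | x <= eta]); last exact: closed_le.
move=> p _; apply: (continuous_big add_continuous) => {p}j _.
(* If q_j = 0, both sides vanish since p_j / 0 = 0 and ln 0 = 0. *)
have -> : (fun p : 'rV[R]_s => p 0 j * ln (p 0 j / q 0 j)) =
    (fun p => q 0 j * (p 0 j / q 0 j * ln (p 0 j / q 0 j))).
  apply/funext => r; have [->|qj] := eqVneq (q 0 j) 0.
    by rewrite invr0 mulr0 ln0// !mulr0.
  by rewrite [RHS]mulrA [q 0 j * _]mulrCA mulfV// mulr1.
move=> p; apply: (@continuousM R _ (fun=> q 0 j)
  (fun p => p 0 j / q 0 j * ln (p 0 j / q 0 j))); first exact: cst_continuous.
apply: (@continuous_comp _ _ _ (fun p : 'rV[R]_s => p 0 j / q 0 j)
  (fun x => x * ln x)).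
  apply: (@continuousM R _ (fun p : 'rV[R]_s => p 0 j) (fun=> (q 0 j)^-1)).
    exact: coord_continuous.
  exact: cst_continuous.
exact: continuous_mul_ln.
Qed.

Lemma compact_simplex_subset (K : set 'rV[R]_s) :
  closed K -> K `<=` simplex R s -> compact K.
Proof.
move=> cK Ks.
have cube : compact
    [set p : 'rV[R]_s | forall j, `[0 : R, 1]%classic (p ord0 j)].
  apply: (rV_compact (A := fun=> `[0 : R, 1]%classic)) => j.
  exact: segment_compact.
apply: subclosed_compact cK cube _ => p /Ks [p0 p1] j.
rewrite /= in_itv/= p0/= -p1 (bigD1 j)//= lerDl.
exact: sumr_ge0.
Qed.

End entropy_function.

(** A filter on the subtype is pushed forward along the inclusion; a cluster point of the image
    pulls back because open sets of the subtype are traces. *)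
Lemma compact_subtype {V : topologicalType} (A : set V) (K : set A) :
  compact (set_val @` K) -> compact K.
Proof.
move=> cK F FF FK.
have [|_ [[x Kx <-] Fx]] := cK (set_val @ F) _.
  by rewrite /fmap/=; apply: filterS FK => x Kx; exists x.
exists x; split => // B C FB [_ [[W oW <-] Wx] WC].
have [||_ [[b Bb <-] Wb]] := Fx (set_val @` B) W.
- by rewrite /fmap/=; apply: filterS FB => b Bb; exists b.
- exact: open_nbhs_nbhs.
by exists b; split => //; exact: WC.
Qed.

(** * Rate functions and the contraction principle *)

Section rate_functions.
Context {R : realType}.

Lemma closed_level_lower_semicontinuous {V : topologicalType}
    (I : V -> \bar R) :
  (forall a : R, closed [set v | (I v <= a%:E)%E]) -> lower_semicontinuous I.
Proof.
move=> cI; apply/lower_semicontinuousP => a.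
rewrite (_ : [set x | _] = ~` [set v | (I v <= a%:E)%E]).
  exact: closed_openC.
by apply/seteqP; split=> v /=; rewrite ltNge => /negP.
Qed.

Lemma contraction_principle (d : measure_display) (T : measurableType d)
    (P : probability T R) (V W : topologicalType) (f : V -> W)
    (Z : nat -> T -> V) (I : V -> \bar R) :
    hausdorff_space W -> continuous f ->
    large_deviation_principle P Z I -> good_rate_function I ->
  let J w := ereal_inf [set I v | v in [set v | f v = w]] in
  large_deviation_principle P (fun n => f \o Z n) J /\ good_rate_function J.
Proof.
move=> hW cf [Zm I0 _ lower upper] gI J.
have J0 w : (0 <= J w)%E by apply: le_ereal_inf_tmp => _ [v _ <-].
(* An infimum over [B] of infima over fibres is one infimum over the preimage, so both large
   deviation bounds transfer to [J]. *)
have JE (B : set W) : ereal_inf (J @` B) = ereal_inf (I @` (f @^-1` B)).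
  apply/eqP; rewrite eq_le; apply/andP; split.
    apply: le_ereal_inf_tmp => _ [v Bv <-]; apply: ge_ereal_inf.
    by exists (J (f v)); [exists (f v)|apply: ereal_inf_lbound; exists v].
  apply: le_ereal_inf_tmp => _ [w Bw <-].
  apply: le_ereal_inf_tmp => _ [v vw <-].
  by apply: ereal_inf_lbound; exists v => //=; rewrite vw.
have compact_image (a : R) : 0 <= a -> compact (f @` [set v | (I v <= a%:E)%E]).
  move=> a0; apply: continuous_compact (gI _ a0).
  exact: continuous_subspaceT.
(* Intersecting over b > a spares us the attainment of the infimum. *)
have levelE (a : R) : [set w | (J w <= a%:E)%E] =
    \bigcap_(b in [set b : R | a < b]) (f @` [set v | (I v <= b%:E)%E]).
  apply/seteqP; split=> [w Ja b /= ab|w Jw].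
    have /ereal_inf_lt[_ [v vw <-] vb] : (J w < b%:E)%E.
      by apply: (le_lt_trans Ja); rewrite lte_fin.
    by exists v => //=; exact: ltW.
  apply/lee_addgt0Pr => e e0.
  have [|v /= va <-] := Jw (a + e); first by rewrite /= ltrDl.
  by apply: ge_ereal_inf; exists (I v) => //; exists v.
have closed_level (a : R) : closed [set w | (J w <= a%:E)%E].
  (* Lower semicontinuity needs every real level; negative ones are empty, the others are
     intersections of compact, hence closed, images. *)
  have [a0|a0] := ltP a 0.
    rewrite (_ : [set w | _] = set0); first exact: closed0.
    rewrite -subset0 => w /= Jw.
    by have := le_trans (J0 w) Jw; rewrite lee_fin leNgt a0.
  rewrite levelE; apply: closed_bigI => b /= ab.
  by apply: (compact_closed hW); apply: compact_image; exact: le_trans (ltW ab).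
split; last first.
  move=> a a0.
  apply: subclosed_compact (closed_level a) (compact_image (a + 1) _) _.
    by rewrite addr_ge0.
  by rewrite levelE => w; apply; rewrite /= ltrDl.
have cfo (O : set W) : open O -> open (f @^-1` O).
  by move=> oO; apply: open_comp => // v _; exact: cf.
split=> //.
- by move=> n O /cfo; exact: Zm.
- exact: closed_level_lower_semicontinuous.
- by move=> O /cfo oO; rewrite JE; exact: lower.
- move=> C cC; rewrite JE; apply: upper.
  by apply: preimage_closed => // v _; exact: cf.
Qed.

End rate_functions.

(** * Sanov's theorem on the simplex and its contraction *)

Section sanov.
Context {R : realType} {s : nat} {d : measure_display} {T : measurableType d}.

Lemma good_relative_entropy (q : simplex R s) : good_rate_function
  (fun p : simplex R s => relative_entropy (set_val p) (set_val q)).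
Proof.
move=> eta _; apply: compact_subtype; rewrite (_ : _ @` _ =
  [set p | simplex R s p /\ (relative_entropy p (set_val q) <= eta%:E)%E]).
  by apply: compact_simplex_subset; [exact: closed_entropy_level|move=> p []].
apply/seteqP; split=> [_ [p pD <-]|p [ps pD]].
  by split=> //; exact: set_valP.
by exists (SigSub (mem_set ps)).
Qed.

Lemma sanov (P : probability T R) (X : nat -> T -> 'I_s) (q : simplex R s) :
    discrete_random_variables X -> mutually_independent P X ->
    (forall i j, P (X i @^-1` [set j]) = (set_val q 0 j)%:E) ->
  large_deviation_principle P (empirical R X)
    (fun p : simplex R s => relative_entropy (set_val p) (set_val q)).
Proof.
move=> X_rv X_indep X_law.
have logE B : (fun n => (n.+1%:R^-1)%:E * lne (P (empirical R X n @^-1` B)))%E =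
    (fun n => (n.+1%:R^-1)%:E * lne (\sum_(x : {ffun 'I_n.+1 -> 'I_s} |
       word_type x \in B) weight (set_val q) x)%:E)%E.
  by apply/funext => n; rewrite (empirical_prob X_rv X_indep X_law).
split.
- by move=> n O _; exact: measurable_empirical.
- by move=> p; apply: relative_entropy_ge0; exact: set_valP.
- apply: closed_level_lower_semicontinuous => a.
  rewrite (_ : [set v | _] = set_val @^-1`
    [set p | simplex R s p /\ (relative_entropy p (set_val q) <= a%:E)%E]).
    apply: preimage_closed; last exact: closed_entropy_level.
    by move=> p _; exact: initial_continuous.
  by apply/seteqP; split=> [p pa|p []//]; split=> //; exact: set_valP.
- by move=> O oO; rewrite logE; exact: weight_sum_lower.
- by move=> C _; rewrite logE; exact: weight_sum_upper.
Qed.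

End sanov.

Theorem proposition2p1 (R : realType) (s : nat) (s_ge1 : (1 <= s)%N)
    (mu : 'I_s -> probability (measurableTypeR R) R)
    (rho : probability (measurableTypeR R) R -> R) (pi : simplex R s)
    (d : measure_display) (T : measurableType d) (P : probability T R)
    (X : nat -> T -> 'I_s)
    (X_rv : discrete_random_variables X)
    (X_indep : mutually_independent P X)
    (X_law : forall i j, P (X i @^-1` [set j]) = (set_val pi 0 j)%:E)
    (rho_cont : continuous (fun p : simplex R s => rho (mixture mu p))) :
  large_deviation_principle P
    (fun n w => rho (mixture mu (empirical R X n w)))
    (mixture_rate mu rho pi) /\
  good_rate_function (mixture_rate mu rho pi).
Proof.
(* [mixture_rate] unfolds to the infimum of the relative entropy over the fibres of
   [p |-> rho (mixture mu p)], which is the contracted rate function. *)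
exact: (contraction_principle (@Rhausdorff R) rho_cont
  (sanov X_rv X_indep X_law) (@good_relative_entropy _ _ pi)).
Qed.
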